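(* Let $G$ be a finite group with center $Z(G)$ such that $G/Z(G)$ is isomorphic to the dihedral group $D_{2m}$ of order $2m$, where $m\ge 3$, and let $n=|Z(G)|$. Then the signless Laplacian spectrum of the non-commuting graph $\Gamma_G$ is $$\left\{((2m-2)n)^{m(n-1)},\ (mn)^{(m-1)n-1},\ ((2m-3)n)^{m-1},\ \left(\tfrac{n(4m-3+\sqrt{8m^2-16m+9})}{2}\right)^1,\ \left(\tfrac{n(4m-3-\sqrt{8m^2-16m+9})}{2}\right)^1\right\}$$ and its signless Laplacian energy is $$LE^+(\Gamma_G)=\begin{cases}\frac{12n^2-3n}{5}+n\sqrt{33}, & \text{if } m=3,\\[2pt] \frac{48n^2-29n}{7}+n\sqrt{73}, & \text{if } m=4,\\[2pt] \frac{(2m^3-6m^2+4m)n^2-(4m^2-8m+3)n}{2m-1}+n\sqrt{8m^2-16m+9}, & \text{if } m\ge 5.\end{cases}$$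
   Context: For a finite non-abelian group $G$ with center $Z(G)$, the non-commuting graph $\Gamma_G$ is the simple undirected graph with vertex set $G\setminus Z(G)$ in which $x,y$ are adjacent iff $xy\ne yx$. For a finite simple graph $\mathcal G$ with vertex set $v(\mathcal G)$, edge set $e(\mathcal G)$, adjacency matrix $A(\mathcal G)$ and diagonal degree matrix $D(\mathcal G)$, the signless Laplacian matrix is $Q(\mathcal G)=D(\mathcal G)+A(\mathcal G)$, and its signless Laplacian spectrum is the multiset of eigenvalues of $Q(\mathcal G)$. The notation $\{(\gamma_1)^{d_1},\dots,(\gamma_l)^{d_l}\}$ means the multiset in which $\gamma_r$ is listed $d_r$ times (entries with $d_r=0$ are absent; coinciding listed values have their multiplicities added). The signless Laplacian energy is $LE^+(\mathcal G)=\sum_{\gamma}\left|\gamma-\frac{2|e(\mathcal G)|}{|v(\mathcal G)|}\right|$, the sum being over the signless Laplacian spectrum with multiplicity. *)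

(* Defs.v *)
From mathcomp Require Import all_boot all_order all_algebra all_fingroup all_solvable.

Set Implicit Arguments.
Unset Strict Implicit.
Unset Printing Implicit Defensive.

Import Order.TTheory GRing.Theory Num.Theory.

Local Open Scope ring_scope.

Record sgraph := SGraph {
  vertex : finType;
  adj : rel vertex;
  adj_sym : symmetric adj;
  adj_irrefl : irreflexive adj }.

Section Graph.
Variable g : sgraph.

Definition edges : {set {set vertex g}} :=
  [set e | [exists x, exists y, adj x y && (e == [set x; y])]].

Definition degree (x : vertex g) : nat := #|[set y | adj x y]|.

(* Matrices are indexed by 'I_#|V|, identified with the vertex set V through
   the bijection enum_val. *)
Definition adjacency_mx (R : pzSemiRingType) : 'M[R]_#|vertex g| :=
  \matrix_(i, j) (adj (enum_val i) (enum_val j))%:R.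

Definition degree_mx (R : pzSemiRingType) : 'M[R]_#|vertex g| :=
  diag_mx (\row_i (degree (enum_val i))%:R).

Definition signless_laplacian (R : pzSemiRingType) : 'M[R]_#|vertex g| :=
  degree_mx R + adjacency_mx R.

End Graph.

Arguments adjacency_mx g R : clear implicits.
Arguments degree_mx g R : clear implicits.
Arguments signless_laplacian g R : clear implicits.

(* The multiset of eigenvalues (roots of the characteristic polynomial with
   their multiplicities), as a list in unspecified order: compare with
   perm_eq. *)
Definition spectrum (C : closedFieldType) (n : nat) (A : 'M[C]_n) : seq C :=
  sval (closed_field_poly_normal (char_poly A)).

Lemma char_poly_spectrum (C : closedFieldType) (n : nat) (A : 'M[C]_n) :
  char_poly A = \prod_(z <- spectrum A) ('X - z%:P).
Proof.
rewrite /spectrum; case: closed_field_poly_normal => r /= {1}->.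
by rewrite (monicP (char_poly_monic A)) scale1r.
Qed.

Definition signless_laplacian_energy (C : numClosedFieldType) (g : sgraph) : C :=
  \sum_(z <- spectrum (signless_laplacian g C))
    `| z - (2 * #|edges g|)%:R / #|vertex g|%:R |.

Arguments signless_laplacian_energy C g : clear implicits.

Section NonCommutingGraph.
Variables (gT : finGroupType) (G : {group gT}).

Definition noncomm_vertex : finType := {x : gT | (x \in G :\: 'Z(G))%g}.

Definition noncomm_adj : rel noncomm_vertex :=
  fun x y => (val x * val y != val y * val x)%g.

Lemma noncomm_adj_sym : symmetric noncomm_adj.
Proof. by move=> x y; rewrite /noncomm_adj eq_sym. Qed.

Lemma noncomm_adj_irrefl : irreflexive noncomm_adj.
Proof. by move=> x; rewrite /noncomm_adj eqxx. Qed.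

Definition noncommuting_graph : sgraph :=
  SGraph noncomm_adj_sym noncomm_adj_irrefl.

End NonCommutingGraph.

(* Main.v *)
(* G has an abelian subgroup A of index 2, the preimage of the rotations of
   D_2m, and an element of A commuting with some x outside A is central.  Hence
   two vertices commute iff both lie in A or both lie in one coset of Z(G)
   outside A: the non-commuting graph is complete multipartite, with one part
   of size (m-1)n and m parts of size n.

   For a complete multipartite graph with V vertices and parts of sizes n_i,
   put s = X - V.  The matrix X - Q is diagonal, plus the block matrix of the
   relation "same part", minus the all-ones matrix; applying
   det(1 + AB) = det(1 + BA) twice gives the characteristic polynomial
   prod_i (s + n_i)^(n_i - 1) (s + 2 n_i) * (1 - sum_i n_i / (s + 2 n_i)).

   The mean degree is 3m(m-1)n/(2m-1), and the three cases of the energy come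
   from the sign of m^2 - 5m + 3, which is negative exactly for m = 3, 4. *)

Require Import Defs.
From mathcomp Require Import all_boot all_order all_algebra all_fingroup all_solvable.
From mathcomp Require Import ring zify.

Set Implicit Arguments.
Unset Strict Implicit.
Unset Printing Implicit Defensive.

Import Order.TTheory GRing.Theory Num.Theory.

(** * Commutation in a group with dihedral central quotient *)

Section AbelianIndexTwo.
Local Open Scope group_scope.

(** The dihedral presentation yields generators x, y of [H] with x^m = y^2 = 1. As <y> normalizes
    <x>, 2m = |H| is at most #[x] #[y], which forces #[x] = m. *)
Lemma dihedral_rotation (gT : finGroupType) (H : {group gT}) (m : nat) :
    1 < m -> H \isog [set: 'D_(2 * m)] ->
  exists x, [/\ x \in H, #[x] = m & #|H| = (2 * m)%N].
Proof.
move=> m_gt1; have D2mE : 'D_(2 * m) \isog Grp (x : y : x ^+ m, y ^+ 2, x ^ y = x^-1).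
  by rewrite mul2n; apply: Grp_dihedral.
case/(isoGrpP _ D2mE) => [oH].
rewrite cardsT mul2n -cardsT card_dihedral // -mul2n in oH.
case/existsP=> -[x y] /= /eqP[gen_xy xm1 y2 xJy].
have nxy : <[y]> \subset 'N(<[x]>) by rewrite norms_cycle xJy groupV cycle_id.
exists x; split=> //; first by rewrite -gen_xy mem_gen // inE cycle_id.
have le_xm : #[x] <= m by rewrite dvdn_leq ?order_dvdn ?xm1 // ltnW.
have le_y2 : #[y] <= 2 by rewrite dvdn_leq // order_dvdn y2.
apply/eqP; rewrite eqn_leq le_xm -(leq_pmul2l (isT : 0 < 2)) -oH -gen_xy.
rewrite norm_joinEr // [X in _ <= X]mulnC.
apply: leq_trans (leq_mul (leqnn _) le_y2).
by rewrite mul_cardG leq_pmulr ?cardG_gt0.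
Qed.

(** [A] is the preimage of the rotation subgroup: cyclic modulo a central subgroup, hence
    abelian. *)
Lemma center_quotient_dihedral (gT : finGroupType) (G : {group gT}) (m : nat) :
    1 < m -> G / 'Z(G) \isog [set: 'D_(2 * m)] ->
  exists A : {group gT},
    [/\ 'Z(G) \subset A, A \subset G, abelian A, #|A| = (m * #|'Z(G)|)%N
      & #|G : A| = 2].
Proof.
move=> m_gt1 /(dihedral_rotation m_gt1)[x [GZx ox oGZ]].
have sZG : 'Z(G) \subset G := center_sub G.
have Z_G : 'Z(G) <| G := center_normal G.
have sAG : coset 'Z(G) @*^-1 <[x]> \subset G.
  have sxGZ : <[x]> \subset G / 'Z(G) by rewrite cycle_subG.
  by apply: subset_trans (morphpreS _ sxGZ) _; rewrite quotientGK.
exists (coset 'Z(G) @*^-1 <[x]>)%G; split.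
- exact: sub_cosetpre.
- exact: sAG.
- apply: (@cyclic_factor_abelian _ 'Z(G)).
    rewrite subsetI sub_cosetpre; apply: subset_trans (subsetIr G _) _.
    exact: centS.
  by rewrite cosetpreK cycle_cyclic.
- by rewrite card_cosetpre -orderE ox mulnC.
apply/eqP; rewrite -(eqn_pmul2l (cardG_gt0 (coset 'Z(G) @*^-1 <[x]>))).
rewrite Lagrange // card_cosetpre -orderE ox -mulnA [(m * 2)%N]mulnC -oGZ.
by rewrite card_quotient ?normal_norm // Lagrange.
Qed.

(** G is the union of [A] and [A x], and [a] commutes with [A] and with [x]. *)
Lemma commute_index2_center (gT : finGroupType) (G A : {group gT}) (a x : gT) :
    A \subset G -> #|G : A| = 2 -> abelian A -> a \in A -> x \in G :\: A ->
  commute a x -> a \in 'Z(G).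
Proof.
move=> sAG iA2 abA Aa GAx cax; have [Gx _] := setDP GAx.
rewrite inE (subsetP sAG) //=; apply/centP => g Gg.
have [Ag|nAg] := boolP (g \in A); first exact: (centsP abA).
have: g \in A :* x by rewrite (rcoset_index2 sAG iA2 GAx) inE nAg.
case/rcosetP => b Ab ->; apply: commuteM => //; exact: (centsP abA).
Qed.

(* Names the part of the multipartite graph that contains [x]. *)
Definition commuting_class (gT : finGroupType) (G A : {group gT}) (x : gT) :
  coset_of 'Z(G) := if x \in A then 1 else coset 'Z(G) x.

Lemma commute_commuting_class (gT : finGroupType) (G A : {group gT}) :
    'Z(G) \subset A -> A \subset G -> #|G : A| = 2 -> abelian A ->
  {in G :\: 'Z(G) &, forall x y,
    (x * y == y * x) = (commuting_class G A x == commuting_class G A y)}.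
Proof.
move=> sZA sAG iA2 abA.
have Z_G : 'Z(G) <| G := center_normal G.
have out_neq1 z : z \in G -> z \notin A -> coset 'Z(G) z != 1.
  move=> Gz; apply: contra => /eqP cz1; apply: (subsetP sZA).
  by rewrite coset_idr ?(subsetP (normal_norm Z_G)).
have mixed x y : x \in G :\: 'Z(G) -> y \in G -> x \in A -> y \notin A ->
   x * y != y * x.
  move=> /setDP[_ nZx] Gy Ax nAy; apply: contra nZx => /eqP.
  by apply: commute_index2_center Ax _; rewrite // inE nAy.
move=> x y Vx Vy; have [[Gx _] [Gy _]] := (setDP Vx, setDP Vy).
rewrite /commuting_class; case: ifPn => Ax; case: ifPn => Ay.
- by rewrite eqxx (centsP abA _ Ax _ Ay) eqxx.
- by rewrite [1 == _]eq_sym (negPf (out_neq1 _ _ _)) // (negPf (mixed _ _ _ _ _ _)).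
- by rewrite (negPf (out_neq1 _ _ _)) // eq_sym (negPf (mixed _ _ _ _ _ _)).
(* Both elements now lie in the coset [A x]. With y = a x, they commute iff x and a do, which by
   [commute_index2_center] means that a is central, i.e. that x and y agree modulo Z(G). *)
have [a Aa ->] : exists2 a, a \in A & y = a * x.
  have: y \in A :* x by rewrite (rcoset_index2 sAG iA2) inE ?Ax ?Ay.
  by case/rcosetP => a; exists a.
have Ga := subsetP sAG a Aa; have nZ := subsetP (normal_norm Z_G).
have GAx : x \in G :\: A by rewrite inE Ax.
have cM : coset 'Z(G) (a * x) = coset 'Z(G) a * coset 'Z(G) x.
  by rewrite morphM ?nZ.
rewrite cM mulgA; apply/eqP/eqP => [/mulIg cxa|cx_eq].
  have Za := commute_index2_center sAG iA2 abA Aa GAx (esym cxa).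
  by rewrite (coset_id Za) mul1g.
have ca1 : coset 'Z(G) a = 1 by apply: (mulIg (coset 'Z(G) x)); rewrite mul1g -cx_eq.
have /centerP[_ cGa] := coset_idr (nZ _ Ga) ca1.
by rewrite cGa.
Qed.

(** Label 1 collects A \ Z(G), and a coset of Z(G) in G outside A collects all its elements.
    Nontrivial elements of A / Z(G) and cosets not contained in G label nothing. *)
Lemma card_commuting_class (gT : finGroupType) (G A : {group gT})
    (c : coset_of 'Z(G)) :
    'Z(G) \subset A -> A \subset G ->
  #|[set x in G :\: 'Z(G) | commuting_class G A x == c]| =
    if c == 1 then (#|A| - #|'Z(G)|)%N
    else if c \in (G / 'Z(G)) :\: (A / 'Z(G)) then #|'Z(G)| else 0%N.
Proof.
move=> sZA sAG; have nZ := subsetP (normal_norm (center_normal G)).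
have sZG := center_sub G.
have coset_in z : z \in G -> coset 'Z(G) z \in A / 'Z(G) -> z \in A.
  move=> Gz Acz; have nZA : 'Z(G) <| A by apply: normalS (center_normal G).
  have: z \in coset 'Z(G) @*^-1 (A / 'Z(G)) by apply/morphpreP; rewrite nZ.
  by rewrite quotientGK.
have out_neq1 z : z \in G -> z \notin A -> coset 'Z(G) z != 1.
  by move=> Gz; apply: contra => /eqP cz1; apply: coset_in; rewrite // cz1 group1.
case: eqVneq => [->|c_neq1].
  rewrite -cardsDS //; apply: eq_card => x; rewrite !inE /commuting_class.
  case: (boolP (x \in A)) => Ax; first by rewrite eqxx (subsetP sAG) // !andbT.
  rewrite andbF; case: (boolP (x \in G)) => Gx; last by rewrite andbF.
  by rewrite (negPf (out_neq1 _ _ _)) ?andbF.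
case: ifPn => [/setDP[/morphimP[x nx Gx ->] nAx]|nc].
  have nxA : x \notin A by apply: contra nAx => Ax; apply: mem_quotient.
  rewrite -(card_rcoset _ x); apply: eq_card => y; apply/setIdP/rcosetP => [[]|].
    case/setDP=> Gy _; rewrite /commuting_class; case: ifP => [_|_ /eqP cyx].
      by rewrite eq_sym (negPf (out_neq1 _ _ _)).
    exists (y * x^-1); last by rewrite mulgKV.
    have cM : coset 'Z(G) (y * x^-1) = coset 'Z(G) y * (coset 'Z(G) x)^-1.
      by rewrite morphM ?groupV ?nZ // morphV ?nZ.
    by apply: coset_idr; rewrite ?groupM ?groupV ?nZ // cM cyx mulgV.
  case=> z Zz ->; have Gz := subsetP sZG z Zz.
  have zxA : z * x \notin A by rewrite groupMl // (subsetP sZA).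
  rewrite /commuting_class (negPf zxA) (coset_kerl _ Zz); split=> //.
  by rewrite inE (groupM Gz Gx) andbT; apply: contra zxA; apply: (subsetP sZA).
apply/eqP; rewrite cards_eq0; apply/eqP/setP => x; rewrite in_set0.
apply: contraNF nc => /setIdP[/setDP[Gx _]]; rewrite /commuting_class.
case: ifP => [_ /eqP c1|/negbT nAx /eqP <-]; first by rewrite c1 eqxx in c_neq1.
by rewrite inE (mem_quotient _ Gx) andbT; apply: contra nAx; apply: coset_in.
Qed.

End AbelianIndexTwo.

(** * Determinants with a complete multipartite pattern *)

Local Open Scope ring_scope.

(** Multiplying [X] by the unipotent [L] on either side gives block triangular matrices, with
    determinants det(1 + AB) and det(1 + BA); both equal det X. *)
Lemma det_add1_mulmxC (R : comNzRingType) (m n : nat)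
    (A : 'M[R]_(m, n)) (B : 'M[R]_(n, m)) :
  \det (1%:M + A *m B) = \det (1%:M + B *m A).
Proof.
pose L : 'M[R]_(m + n) := block_mx 1%:M 0 B 1%:M.
pose X : 'M[R]_(m + n) := block_mx 1%:M A (- B) 1%:M.
have detL : \det L = 1 by rewrite det_lblock !det1 mulr1.
have eX1 : X *m L = block_mx (1%:M + A *m B) A 0 1%:M.
  by rewrite mulmx_block !(mulmx1, mul1mx, mulmx0) addNr !add0r.
have eX2 : L *m X = block_mx 1%:M A 0 (1%:M + B *m A).
  by rewrite mulmx_block !(mulmx1, mul1mx, mul0mx) !addr0 subrr addrC.
move: (congr1 determinant eX1) (congr1 determinant eX2).
by rewrite !det_ublock !det_mulmx detL !(det1, mulr1, mul1r) => <- <-.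
Qed.

(** [S] is the incidence matrix of parts against indices and [K] the identity minus the all-ones
    matrix. Swapping factors reduces the size from N to k; a second swap, on a rank-one term,
    reduces it to 1. *)
Lemma det_multipartite (F : fieldType) (N k : nat) (p : 'I_N -> 'I_k)
    (e : 'I_N -> F) (w := fun i => \sum_(v | p v == i) (e v)^-1) :
  (forall v, e v != 0) -> (forall i, 1 + w i != 0) ->
  \det (\matrix_(u, v) (e u *+ (u == v) - (p u != p v)%:R)) =
    (\prod_v e v) * (\prod_i (1 + w i)) * (1 - \sum_i w i / (1 + w i)).
Proof.
move=> e_neq0 w_neq0.
pose S : 'M[F]_(k, N) := \matrix_(i, v) (p v == i)%:R.
pose E : 'M[F]_N := diag_mx (\row_v e v).
pose E' : 'M[F]_N := diag_mx (\row_v (e v)^-1).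
pose K : 'M[F]_k := 1%:M - const_mx 1.
pose W : 'M[F]_k := diag_mx (\row_i (1 + w i)).
pose r : 'rV[F]_k := \row_i (w i / (1 + w i)).
have -> : \matrix_(u, v) (e u *+ (u == v) - (p u != p v)%:R) =
    E *m (1%:M + (E' *m S^T) *m (K *m S)).
  have -> : K *m S = \matrix_(i, v) - (p v != i)%:R.
    apply/matrixP => i v; rewrite mulmxBl mul1mx !mxE.
    rewrite (bigD1 (p v)) //= !mxE eqxx mulr1 big1 => [|j /negPf]; last first.
      by rewrite eq_sym !mxE => ->; rewrite mulr0.
    by rewrite addr0; case: eqP => /=; rewrite ?subrr ?oppr0 // sub0r.
  apply/matrixP => u v; rewrite mul_diag_mx !mxE mulrDr; congr (_ + _).
    by rewrite mulr_natr.
  rewrite mulrC (bigD1 (p u)) //= big1 => [|i /negPf ipu]; last first.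
    by rewrite mul_diag_mx !mxE eq_sym ipu mulr0 mul0r.
  rewrite addr0 mul_diag_mx !mxE eqxx mulr1 mulrC mulrA divff // mul1r.
  by rewrite eq_sym.
rewrite det_mulmx det_diag -mulrA; congr (_ * _).
  by apply: eq_bigr => v _; rewrite mxE.
rewrite det_add1_mulmxC.
(* Here S E' S^T = diag(w), and 1 + K diag(w) = W - J diag(w) with J all ones; factoring out W
   leaves the identity plus a rank-one matrix. *)
have -> : 1%:M + K *m S *m (E' *m S^T) = (1%:M + const_mx (-1) *m r) *m W.
  have -> : K *m S *m (E' *m S^T) = K *m diag_mx (\row_i w i).
    rewrite -mulmxA; congr (_ *m _); apply/matrixP => i j; rewrite !mxE.
    rewrite /w; case: (eqVneq i j) => [<-|ij] /=.
      rewrite mulr1n [RHS]big_mkcond; apply: eq_bigr => v _ /=.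
      rewrite mul_diag_mx !mxE; case: eqP => _; by rewrite ?mulr1 ?mul1r ?mul0r.
    rewrite mulr0n big1 // => v _; rewrite mul_diag_mx !mxE.
    case: (eqVneq (p v) i) => [->|]; last by rewrite mul0r.
    by rewrite (negPf ij) !mulr0.
  apply/matrixP => i j; rewrite !mul_mx_diag !mxE big_ord1 !mxE.
  have := w_neq0 j; case: (i == j) => /= h; by field.
rewrite det_mulmx det_add1_mulmxC det_diag mulrC; congr (_ * _).
  by apply: eq_bigr => v _; rewrite mxE.
rewrite det_mx11 !mxE -sumrN; congr (_ + _).
by apply: eq_bigr => i _; rewrite !mxE mulrN1.
Qed.

(** Evaluates the multipartite formula for one part of size [k] and [l] parts of size [j]: [a], [b]
    stand for s + k, s + 2k, [c], [d] for s + j, s + 2j, and [x], [y] for the two sizes as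
    scalars. *)
Lemma multipartite_clear_denominators (K : fieldType) (a b c d x y : K)
    (k j l : nat) :
    a != 0 -> b != 0 -> c != 0 -> d != 0 -> (0 < k)%N -> (0 < j)%N -> (0 < l)%N ->
  a ^+ k * (b / a) * (c ^+ j * (d / c)) ^+ l
    * (1 - (x / b + y / d *+ l)) =
  c ^+ (l * (j - 1)) * a ^+ (k - 1) * d ^+ (l - 1)
    * (b * d - x * d - y *+ l * b).
Proof.
case: k j l => [//|k] [//|j] [//|l] a0 b0 c0 d0 _ _ _; rewrite !subSS !subn0.
have -> : c ^+ j.+1 * (d / c) = c ^+ j * d by rewrite exprS; field.
rewrite exprMn -exprM [(j * _)%N]mulnC !exprS.
rewrite -[y *+ _]mulr_natr -[y / d *+ _]mulr_natr.
move: (c ^+ _) (a ^+ k) (d ^+ l) l.+1%:R => c' a' d' z.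
by field; rewrite a0 b0 d0.
Qed.

(** * Edge count and characteristic polynomial of complete multipartite graphs *)

Lemma handshake (g : sgraph) : (\sum_(x : vertex g) degree x = 2 * #|edges g|)%N.
Proof.
(* Neighbours y of x correspond to edges {x, y} through x, injectively because y differs from x. *)
have degE x : degree x = (\sum_(e in edges g) (x \in e))%N.
  rewrite -big_mkcondr sum1_card /degree.
  rewrite -(card_in_imset (f := fun y => [set x; y])) => [|y z]; last first.
    rewrite !inE => xy xz /setP/(_ y); rewrite !inE eqxx orbT.
    case/esym/orP => /eqP // yx; first by rewrite yx adj_irrefl in xy.
  apply: eq_card => e; rewrite [RHS]unfold_in; apply/imsetP/andP => [[y]|[]].
    rewrite ?inE => xy ->; split; last exact: set21.
    by apply/existsP; exists x; apply/existsP; exists y; rewrite xy eqxx.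
  rewrite inE => /existsP[a /existsP[b /andP[ab /eqP->]]]; rewrite !inE.
  case/orP => /eqP->; first by exists b; rewrite ?inE.
  by exists a; rewrite ?inE 1?adj_sym // setUC.
rewrite (eq_bigr _ (fun x _ => degE x)) exchange_big /=.
rewrite mulnC -sum_nat_const; apply: eq_bigr => e.
rewrite inE => /existsP[a /existsP[b /andP[ab /eqP->]]].
rewrite -big_mkcond sum1_card cards2; case: eqP ab => // ->.
by rewrite adj_irrefl.
Qed.

Section Multipartite.
Variables (g : sgraph) (I : finType) (p : vertex g -> I).
Hypothesis adj_p : forall x y, adj x y = (p x != p y).

Definition part_size (i : I) : nat := #|[set x | p x == i]|.

Lemma degree_multipartite (x : vertex g) :
  (degree x + part_size (p x))%N = #|vertex g|.
Proof.
rewrite -cardsT -(cardsID [set y | adj x y] setT); congr (_ + _)%N; apply: eq_card => y.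
  by rewrite !inE.
by rewrite !inE adj_p eq_sym ?andbT negbK.
Qed.

(* Stated in the fraction field of {poly F}, where the denominators are
   automatically nonzero. *)
Lemma char_poly_multipartite (F : fieldType)
    (s : {fraction {poly F}} := tofrac ('X - #|vertex g|%:R%:P)) :
  tofrac (char_poly (signless_laplacian g F)) =
    (\prod_i ((s + (part_size i)%:R) ^+ part_size i *
              ((s + (2 * part_size i)%:R) / (s + (part_size i)%:R))))
    * (1 - \sum_i (part_size i)%:R / (s + (2 * part_size i)%:R)).
Proof.
pose q (u : 'I_#|vertex g|) := enum_rank (p (enum_val u)).
pose e (u : 'I_#|vertex g|) := s + (part_size (p (enum_val u)))%:R.
have tofrac_nat k : (k%:R : {fraction {poly F}}) = tofrac k%:R%:P.
  by rewrite polyC_natr rmorph_nat.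
have s_neq0 k : s + k%:R != 0.
  rewrite tofrac_nat /s -rmorphD tofrac_eq0 -addrA [- _ + _]addrC -opprB -polyCB.
  by rewrite polyXsubC_eq0.
have wE (i : I) : \sum_(u | q u == enum_rank i) (e u)^-1 =
    (part_size i)%:R / (s + (part_size i)%:R).
  rewrite -(big_enum_val_cond (fun x => enum_rank (p x) == enum_rank i)
      (fun x => (s + (part_size (p x))%:R)^-1)) /=.
  rewrite (eq_bigl (fun x => x \in [set x | p x == i])) => [|x]; last first.
    by rewrite !inE (inj_eq enum_rank_inj).
  rewrite (eq_bigr (fun _ => (s + (part_size i)%:R)^-1)) => [|x].
    by rewrite sumr_const -[LHS]mulr_natl.
  by rewrite inE => /eqP->.
have w1E (i : I) : 1 + (part_size i)%:R / (s + (part_size i)%:R)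
   = (s + (2 * part_size i)%:R) / (s + (part_size i)%:R).
  rewrite -[X in X + _ = _](divff (s_neq0 (part_size i))) -mulrDl -addrA.
  by rewrite -natrD addnn mul2n.
have -> : tofrac (char_poly (signless_laplacian g F)) =
    \det (\matrix_(u, v) (e u *+ (u == v) - (q u != q v)%:R)).
  rewrite /char_poly -det_map_mx; congr (\det _); apply/matrixP => u v.
  rewrite !mxE adj_p /q (inj_eq enum_rank_inj).
  (* The degree is V minus the size of the vertex's own part, so X - deg is s plus that size. *)
  have eE : e u = tofrac ('X - (degree (enum_val u))%:R%:P).
    rewrite /e /s tofrac_nat -rmorphD -(degree_multipartite (enum_val u)).
    by rewrite natrD polyCD opprD addrA subrK.
  rewrite eE (tofrac_nat (_ != _)) -tofracMn -tofracB; congr tofrac.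
  by rewrite polyCD polyCMn mulrnBl opprD addrA.
have w_neq0 (i : I) : 1 + \sum_(u | q u == enum_rank i) (e u)^-1 != 0.
  by rewrite wE w1E mulf_neq0 ?invr_eq0.
rewrite det_multipartite => [|u|i]; first last.
- by rewrite -(enum_valK i).
- exact: s_neq0.
rewrite -(big_enum_val (fun x => s + (part_size (p x))%:R)) /=.
rewrite (partition_big p xpredT) //= !(reindex _ (onW_bij _ (@enum_rank_bij I))) /=.
rewrite -big_split; congr (_ * (1 - _)); apply: eq_bigr => i _; last first.
  by rewrite wE w1E invf_div mulrA divfK.
rewrite wE w1E; congr (_ * _).
rewrite (eq_bigl (fun x => x \in [set x | p x == i])) => [|x]; last by rewrite inE.
rewrite (eq_bigr (fun _ => s + (part_size i)%:R)) => [|x]; last by rewrite inE => /eqP->.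
by rewrite prodr_const.
Qed.

Lemma sum_part_size : (\sum_i part_size i)%N = #|vertex g|.
Proof.
rewrite -sum1_card (partition_big p xpredT) //=; apply: eq_bigr => i _.
by rewrite /part_size -sum1_card; apply: eq_bigl => x; rewrite inE.
Qed.

(** * One part of size (m-1)n and m parts of size n *)

Variables (m n : nat) (i0 : I) (B : {set I}).
Hypotheses (m_gt1 : (1 < m)%N) (n_gt0 : (0 < n)%N).
Hypotheses (i0B : i0 \notin B) (cardB : #|B| = m).
Hypothesis part_size_i0 : part_size i0 = ((m - 1) * n)%N.
Hypothesis part_size_B : forall i, i \in B -> part_size i = n.
Hypothesis part_size0 : forall i, i != i0 -> i \notin B -> part_size i = 0%N.

Lemma big_parts (R : Type) (idx : R) (op : Monoid.com_law idx) (f : I -> R) :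
  (forall i, i != i0 -> i \notin B -> f i = idx) ->
  \big[op/idx]_i f i = op (f i0) (\big[op/idx]_(i in B) f i).
Proof.
move=> f0; rewrite (bigID (mem B)) Monoid.mulmC /= (bigD1 i0 i0B) /=.
rewrite big1 ?Monoid.mulm1 // => i /andP[iB i_neq]; exact: f0.
Qed.

Lemma card_vertex_parts : #|vertex g| = ((2 * m - 1) * n)%N.
Proof.
rewrite -sum_part_size big_parts => [|i]; last exact: part_size0.
rewrite (eq_bigr (fun=> n)) => [|i]; last exact: part_size_B.
rewrite sum_nat_const cardB part_size_i0 /= -mulnDl.
by rewrite addnC addnBA 1?ltnW // addnn mul2n.
Qed.

(** With s = X - (2m-1)n, the terms s + n, s + (m-1)n and s + 2n give the linear factors; s +
    2(m-1)n = X - n survives only inside the quadratic. *)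
Lemma char_poly_parts (F : fieldType) (M : F := m%:R) (N : F := n%:R) :
  char_poly (signless_laplacian g F) =
    ('X - ((2 * M - 2) * N)%:P) ^+ (m * (n - 1))
    * ('X - (M * N)%:P) ^+ ((m - 1) * n - 1)
    * ('X - ((2 * M - 3) * N)%:P) ^+ (m - 1)
    * ('X ^+ 2 - ((4 * M - 3) * N)%:P * 'X + (2 * M * (M - 1) * N ^+ 2)%:P).
Proof.
pose T (c : F) : {fraction {poly F}} := tofrac ('X - c%:P).
have T_neq0 c : T c != 0 by rewrite tofrac_eq0 polyXsubC_eq0.
have TE c k : T c + k%:R = T (c - k%:R).
  have -> : (k%:R : {fraction {poly F}}) = tofrac k%:R%:P.
    by rewrite polyC_natr rmorph_nat.
  rewrite /T -tofracD; congr tofrac.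
  by rewrite polyCB opprB -addrA [- _ + _]addrC.
have natM1 : (m - 1)%:R = M - 1 by rewrite natrB // ltnW.
have nat2M1 : (2 * m - 1)%:R = 2 * M - 1 by rewrite natrB ?natrM //; lia.
apply/eqP; rewrite -tofrac_eq char_poly_multipartite card_vertex_parts.
rewrite -/(T _) !big_parts /=; first last.
(* An empty part contributes s^0 (s / s) = 1, which a truncated exponent n_i - 1 would not give. *)
- move=> i ii0 iB; rewrite (part_size0 ii0 iB) muln0 expr0 mul1r divff //.
  by rewrite TE.
- by move=> i ii0 iB; rewrite (part_size0 ii0 iB) mul0r.
rewrite part_size_i0.
set s := T _.
rewrite (eq_bigr (fun=> (s + n%:R) ^+ n * ((s + (2 * n)%:R) / (s + n%:R)))); last first.
  by move=> i iB; rewrite part_size_B.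
rewrite [\sum_(i in B) _](eq_bigr (fun=> n%:R / (s + (2 * n)%:R))); last first.
  by move=> i iB; rewrite part_size_B.
rewrite prodr_const sumr_const cardB {}/s !TE !natrM natM1 nat2M1 -/N.
rewrite (_ : _ - (M - 1) * N = M * N); last by ring.
rewrite (_ : _ - 2 * ((M - 1) * N) = N); last by ring.
rewrite (_ : _ - 2 * N = (2 * M - 3) * N); last by ring.
rewrite (_ : _ - N = (2 * M - 2) * N); last by ring.
rewrite multipartite_clear_denominators ?T_neq0 //; first last.
- exact: ltnW.
- by rewrite muln_gt0 n_gt0 subn_gt0 m_gt1.
apply/eqP; rewrite !tofracM !tofracXn; congr (_ * _).
have tofrac_nat k : (k%:R : {fraction {poly F}}) = tofrac k%:R%:P.
  by rewrite polyC_natr rmorph_nat.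
rewrite -mulrnA !tofrac_nat -!tofracM -!tofracB; congr tofrac.
rewrite !natrM natM1 -/M -/N; ring.
Qed.

(** Each vertex misses exactly its own part, so the degree sum is V^2 minus the sum of the squared
    part sizes. *)
Lemma card_edges_parts : (2 * #|edges g| = 3 * m * (m - 1) * n ^ 2)%N.
Proof.
have sq : (\sum_x part_size (p x) = ((m - 1) * n) ^ 2 + m * n ^ 2)%N.
  transitivity (\sum_i part_size i ^ 2)%N.
    rewrite (partition_big p xpredT) //=; apply: eq_bigr => i _.
    rewrite (eq_bigr (fun=> part_size i)) => [|x /eqP-> //].
    rewrite (eq_bigl (fun x => x \in [set x | p x == i])) => [|x]; last by rewrite inE.
    by rewrite sum_nat_const.
  rewrite big_parts => [|i ii0 iB]; last by rewrite part_size0.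
  rewrite part_size_i0 (eq_bigr (fun=> n ^ 2)%N) => [|i iB]; last by rewrite part_size_B.
  by rewrite sum_nat_const cardB.
have: (\sum_(x : vertex g) degree x + \sum_x part_size (p x) = #|vertex g| ^ 2)%N.
  transitivity (\sum_x (degree x + part_size (p x)))%N; first by rewrite big_split.
  rewrite (eq_bigr (fun=> #|vertex g|)) => [|x _]; last exact: degree_multipartite.
  by rewrite sum_nat_const.
rewrite sq handshake card_vertex_parts; case: m m_gt1 => [//|k] _.
rewrite mulnS !subSS !subn0 => E; apply/eqP.
by rewrite -(eqn_add2r ((k * n) ^ 2 + k.+1 * n ^ 2)%N) E; apply/eqP; ring.
Qed.

End Multipartite.

(** * Distances of the eigenvalues from the mean degree *)

Section Energy.
Variables (C : numClosedFieldType) (m n : nat).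
Hypothesis m_ge3 : (3 <= m)%N.
Let M : C := m%:R.
Let N : C := n%:R.
Let S := sqrtC (8 * M ^+ 2 - 16 * M + 9).
(** The mean degree: 3m(m-1)n^2 divided by (2m-1)n. *)
Let a : C := 3 * M * (M - 1) * N / (2 * M - 1).

Let d_gt0 : 0 < 2 * M - 1.
Proof. by rewrite subr_gt0 /M -natrM ltr1n; lia. Qed.

Let subM_ge0 k : (k <= m)%N -> 0 <= M - k%:R.
Proof. by rewrite subr_ge0 ler_nat. Qed.

Let M1_ge0 : 0 <= M - 1.
Proof. by apply: (subM_ge0 (k := 1)); lia. Qed.

(** Named, like the next two, after the eigenvectors: sum-zero vectors on one coset of reflections,
    sum-zero vectors on the rotations, and sum-zero vectors constant on each coset of reflections
    and zero on the rotations. *)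
Lemma dist_eigenvalue_reflections :
  `|(2 * M - 2) * N - a| = N * (M - 1) * (M - 2) / (2 * M - 1).
Proof.
have -> : (2 * M - 2) * N - a = N * (M - 1) * (M - 2) / (2 * M - 1).
  by rewrite /a; field; rewrite gt_eqF.
apply: ger0_norm; apply: divr_ge0 (ltW d_gt0).
by rewrite !mulr_ge0 ?ler0n ?M1_ge0 ?subM_ge0 //; lia.
Qed.

Lemma dist_eigenvalue_rotations :
  `|M * N - a| = M * N * (M - 2) / (2 * M - 1).
Proof.
have -> : M * N - a = - (M * N * (M - 2) / (2 * M - 1)).
  by rewrite /a; field; rewrite gt_eqF.
rewrite normrN; apply: ger0_norm; apply: divr_ge0 (ltW d_gt0).
by rewrite !mulr_ge0 ?ler0n ?M1_ge0 ?subM_ge0 //; lia.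
Qed.

(** The numerator is n(m(m-5) + 3), nonnegative from m = 5 on. *)
Lemma dist_eigenvalue_cosets : (5 <= m)%N ->
  `|(2 * M - 3) * N - a| = N * (M ^+ 2 - 5 * M + 3) / (2 * M - 1).
Proof.
move=> m_ge5.
have -> : (2 * M - 3) * N - a = N * (M ^+ 2 - 5 * M + 3) / (2 * M - 1).
  by rewrite /a; field; rewrite gt_eqF.
apply: ger0_norm; apply: divr_ge0 (ltW d_gt0).
rewrite mulr_ge0 ?ler0n // expr2 -mulrBl addr_ge0 ?ler0n //.
by rewrite mulr_ge0 ?ler0n ?M1_ge0 ?subM_ge0.
Qed.

(** Multiplied by n^2, this is the discriminant of the quadratic factor in [char_poly_parts]. *)
Lemma discriminant_ge0 : 0 <= 8 * M ^+ 2 - 16 * M + 9.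
Proof.
have -> : 8 * M ^+ 2 - 16 * M + 9 = 8 * (M - 1) ^+ 2 + 1 by ring.
by rewrite addr_ge0 ?mulr_ge0 ?exprn_ge0 ?ler0n ?M1_ge0 ?subM_ge0 //; lia.
Qed.

(* The mean [a] lies between the two roots of the quadratic factor, which are
   [N * S] apart. *)
Lemma dist_eigenvalue_quadratic :
  `|N * (4 * M - 3 + S) / 2 - a| + `|N * (4 * M - 3 - S) / 2 - a| = N * S.
Proof.
(* N r / 2 is the distance from [a] up to the midpoint N (4M - 3) / 2 of the roots, so [a] lies
   between them once r <= S. *)
pose r := (2 * M ^+ 2 - 4 * M + 3) / (2 * M - 1).
have r_ge0 : 0 <= r.
  apply: divr_ge0 (ltW d_gt0).
  have -> : 2 * M ^+ 2 - 4 * M + 3 = 2 * (M - 1) ^+ 2 + 1 by ring.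
  by rewrite addr_ge0 ?mulr_ge0 ?exprn_ge0 ?ler0n ?M1_ge0 ?subM_ge0 //; lia.
have S_ge0 : 0 <= S by rewrite sqrtC_ge0 discriminant_ge0.
have r_le_S : r <= S.
  rewrite -(@ler_pXn2r _ 2) // sqrtCK expr_div_n ler_pdivrMr ?exprn_gt0 //.
  rewrite -subr_ge0.
  (* Expanding in powers of M - 1 makes every coefficient nonnegative. *)
  have -> : (8 * M ^+ 2 - 16 * M + 9) * (2 * M - 1) ^+ 2
      - (2 * M ^+ 2 - 4 * M + 3) ^+ 2 =
      28 * (M - 1) ^+ 4 + 32 * (M - 1) ^+ 3 + 8 * (M - 1) ^+ 2 + 4 * (M - 1).
    by ring.
  by rewrite !addr_ge0 ?mulr_ge0 ?exprn_ge0 ?ler0n ?M1_ge0.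
have -> : N * (4 * M - 3 + S) / 2 - a = N * (S + r) / 2.
  by rewrite /a /r; field; rewrite gt_eqF.
have -> : N * (4 * M - 3 - S) / 2 - a = - (N * (S - r) / 2).
  by rewrite /a /r; field; rewrite gt_eqF.
rewrite normrN !ger0_norm; first by field.
  by rewrite divr_ge0 // mulr_ge0 ?ler0n // subr_ge0.
by rewrite divr_ge0 // mulr_ge0 ?ler0n // addr_ge0.
Qed.

End Energy.

(** * Spectrum and energy of the non-commuting graph *)

Theorem theorem2p19 (C : numClosedFieldType) (gT : finGroupType)
    (G : {group gT}) (m n : nat)
    (hm : (3 <= m)%N)
    (hn : n = #|('Z(G))%g|)
    (hG : ((G / 'Z(G)) \isog [set: 'D_(2 * m)])%g) :
  let Gamma := noncommuting_graph G in
  let M : C := m%:R in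
  let N : C := n%:R in
  let LEp : C := signless_laplacian_energy C Gamma in
  perm_eq (spectrum (signless_laplacian Gamma C))
    (nseq (m * (n - 1)) ((2 * M - 2) * N)
     ++ nseq ((m - 1) * n - 1) (M * N)
     ++ nseq (m - 1) ((2 * M - 3) * N)
     ++ nseq 1 (N * (4 * M - 3 + sqrtC (8 * M ^+ 2 - 16 * M + 9)) / 2)
     ++ nseq 1 (N * (4 * M - 3 - sqrtC (8 * M ^+ 2 - 16 * M + 9)) / 2))
  /\ [/\ m = 3%N ->
           LEp = (12 * N ^+ 2 - 3 * N) / 5 + N * sqrtC 33,
         m = 4%N ->
           LEp = (48 * N ^+ 2 - 29 * N) / 7 + N * sqrtC 73
       & (5 <= m)%N ->
           LEp = ((2 * M ^+ 3 - 6 * M ^+ 2 + 4 * M) * N ^+ 2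
                  - (4 * M ^+ 2 - 8 * M + 3) * N) / (2 * M - 1)
                 + N * sqrtC (8 * M ^+ 2 - 16 * M + 9)].
Proof.
move=> Gamma M N LEp; have m_gt1 : (1 < m)%N by apply: ltnW.
have n_gt0 : (0 < n)%N by rewrite hn cardG_gt0.
have [A [sZA sAG abA oA iA2]] := center_quotient_dihedral m_gt1 hG.
pose p (x : vertex Gamma) := commuting_class G A (val x).
have adj_p x y : adj x y = (p x != p y).
  by rewrite /p -(commute_commuting_class sZA sAG iA2 abA) ?(valP x) ?(valP y).
(* Label 1 stands for A \ Z(G); [B] holds the m cosets of Z(G) in G outside A. *)
pose B := ((G / 'Z(G)) :\: (A / 'Z(G)))%g.
have i0B : 1%g \notin B by rewrite inE group1.
have sizeE c : part_size p c =
    #|[set x in (G :\: 'Z(G))%g | commuting_class G A x == c]|.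
  rewrite /part_size -(card_imset _ val_inj); apply: eq_card => x.
  apply/imsetP/idP => [[y]|].
    by rewrite !inE => /eqP <- ->; have := valP y; rewrite !inE => ->/=.
  case/setIdP => Vx xc; exists (Sub x Vx : noncomm_vertex G) => //.
  by rewrite inE.
have cardB : #|B| = m.
  have oAZ : #|A / 'Z(G)|%g = m.
    rewrite card_quotient -?divgS // ?oA ?mulnK ?cardG_gt0 //.
    by rewrite (subset_trans sAG) ?normal_norm ?center_normal.
  have oGZ : #|G / 'Z(G)|%g = (2 * m)%N.
    rewrite card_quotient ?normal_norm ?center_normal // -divgS ?center_sub //.
    by rewrite -(Lagrange sAG) oA iA2 mulnAC mulnK ?cardG_gt0 // mulnC.
  by rewrite cardsDS ?quotientS // oAZ oGZ mul2n -addnn addnK.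
have size1 : part_size p 1%g = ((m - 1) * n)%N.
  by rewrite sizeE card_commuting_class // eqxx oA -hn mulnBl mul1n.
have sizeB c : c \in B -> part_size p c = n.
  move=> Bc; rewrite sizeE card_commuting_class // -/B Bc -hn.
  by case: eqP Bc => // ->; rewrite (negPf i0B).
have size0 c : c != 1%g -> c \notin B -> part_size p c = 0%N.
  by move=> c1 Bc; rewrite sizeE card_commuting_class // -/B (negPf c1) (negPf Bc).
have spectrumE : perm_eq (spectrum (signless_laplacian Gamma C))
    (nseq (m * (n - 1)) ((2 * M - 2) * N)
     ++ nseq ((m - 1) * n - 1) (M * N)
     ++ nseq (m - 1) ((2 * M - 3) * N)
     ++ nseq 1 (N * (4 * M - 3 + sqrtC (8 * M ^+ 2 - 16 * M + 9)) / 2)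
     ++ nseq 1 (N * (4 * M - 3 - sqrtC (8 * M ^+ 2 - 16 * M + 9)) / 2)).
  (* The product of the X - z determines the multiset of the z, so comparing characteristic
     polynomials suffices. *)
  apply: prod_XsubC_eq; rewrite -char_poly_spectrum.
  rewrite (char_poly_parts adj_p m_gt1 n_gt0 i0B cardB size1 sizeB size0).
  rewrite -/M -/N; set S := sqrtC _.
  have S2 : S ^+ 2 = 8 * M ^+ 2 - 16 * M + 9 by rewrite sqrtCK.
  (* Vieta: the coefficients of the quadratic become the sum and product of the two claimed
     roots. *)
  have -> : (4 * M - 3) * N = N * (4 * M - 3 + S) / 2 + N * (4 * M - 3 - S) / 2 by field.
  have -> : 2 * M * (M - 1) * N ^+ 2 =
      (N * (4 * M - 3 + S) / 2) * (N * (4 * M - 3 - S) / 2).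
    rewrite [RHS](_ : _ = N ^+ 2 * ((4 * M - 3) ^+ 2 - S ^+ 2) / 4); last by field.
    by rewrite S2; field.
  rewrite !big_cat !big_nseq /= !iter_mulr_1 !mulr1 -!(mulrA (_ ^+ _)).
  by do 3 congr (_ * _); rewrite polyCD polyCM; ring.
split=> //.
have m1E : (m - 1)%:R = M - 1 :> C by rewrite natrB // ltnW.
have d1E : (2 * m - 1)%:R = 2 * M - 1 :> C.
  by rewrite natrB ?natrM // (leq_trans (ltnW m_gt1)) ?leq_pmull.
have N0 : N != 0 by rewrite pnatr_eq0 -lt0n.
have dn0 : 2 * M - 1 != 0.
  by rewrite -d1E pnatr_eq0 -lt0n subn_gt0 (leq_trans m_gt1) ?leq_pmull.
(* The eigenvalue (2m-3)n keeps its absolute value, since its side of the mean depends on m. *)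
have LEpE : LEp =
    (m * (n - 1))%:R * (N * (M - 1) * (M - 2) / (2 * M - 1))
    + ((m - 1) * n - 1)%:R * (M * N * (M - 2) / (2 * M - 1))
    + (m - 1)%:R * `|(2 * M - 3) * N - 3 * M * (M - 1) * N / (2 * M - 1)|
    + N * sqrtC (8 * M ^+ 2 - 16 * M + 9).
  have meanE : (2 * #|edges Gamma|)%:R / #|vertex Gamma|%:R
      = 3 * M * (M - 1) * N / (2 * M - 1).
    rewrite (card_edges_parts adj_p m_gt1 i0B cardB size1 sizeB size0).
    rewrite (card_vertex_parts m_gt1 i0B cardB size1 sizeB size0).
    rewrite !natrM m1E d1E -/M -/N.
    by field; rewrite dn0 N0.
  rewrite /LEp /signless_laplacian_energy (perm_big _ spectrumE) meanE.
  rewrite !big_cat !big_nseq /= !iter_addr_0 !addr0.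
  have E1 := @dist_eigenvalue_reflections C m n hm.
  have E2 := @dist_eigenvalue_rotations C m n hm.
  have E3 := @dist_eigenvalue_quadratic C m n hm.
  rewrite -/M -/N in E1 E2 E3.
  rewrite E1 E2 E3 [(m * (n - 1))%:R * _]mulr_natl [(_ - 1)%:R * _]mulr_natl.
  by rewrite [(m - 1)%:R * _]mulr_natl !addrA.
have n1E : (m * (n - 1))%:R = M * (N - 1) :> C by rewrite natrM natrB.
have k1E : ((m - 1) * n - 1)%:R = (M - 1) * N - 1 :> C.
  by rewrite natrB ?natrM ?natrB ?muln_gt0 ?subn_gt0 ?m_gt1 //; apply: ltnW.
rewrite n1E k1E m1E in LEpE.
split=> [m3|m4|m5]; rewrite LEpE.
(* The eigenvalue 3n lies below the mean 18n/5. *)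
- have -> : M = 3 by rewrite /M m3.
  have -> : (2 * 3 - 3) * N - 3 * 3 * (3 - 1) * N / (2 * 3 - 1) = - (3 * N / 5).
    by field.
  rewrite normrN ger0_norm; last by rewrite divr_ge0 ?mulr_ge0 ?ler0n.
  have -> : 8 * 3 ^+ 2 - 16 * 3 + 9 = 33 :> C by ring.
  by field.
(* The eigenvalue 5n lies below the mean 36n/7. *)
- have -> : M = 4 by rewrite /M m4.
  have -> : (2 * 4 - 3) * N - 3 * 4 * (4 - 1) * N / (2 * 4 - 1) = - (N / 7).
    by field.
  rewrite normrN ger0_norm; last by rewrite divr_ge0 ?ler0n.
  have -> : 8 * 4 ^+ 2 - 16 * 4 + 9 = 73 :> C by ring.
  by field.
have := @dist_eigenvalue_cosets C m n hm m5; rewrite -/M -/N => ->.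
by field; rewrite dn0.
Qed.
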